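(* Let $T=\sum_{i=0}^{+\infty}T_i\in\mathrm{Hom}^0(S(V),\mathfrak g)$ be a homotopy $\mathcal O$-operator of weight $0$ on a symmetric graded Lie algebra $(\mathfrak g,[\cdot,\cdot]_{\mathfrak g})$ with respect to an action $\rho:\mathfrak g\to\mathfrak{gl}(V)$ on a graded vector space $V$. Then $(V,\{\theta_k\}_{k=1}^\infty)$ is a pre-Lie$_\infty$ algebra, where $\theta_k:\otimes^kV\to V$ $(k\ge1)$ are the linear maps of degree $1$ defined by $$\theta_k(v_1,\dots,v_k):=\rho\big(T_{k-1}(v_1,\dots,v_{k-1})\big)v_k,\qquad\forall v_1,\dots,v_k\in V.$$
   Context: All vector spaces are over a field of characteristic zero; graded means $\mathbb Z$-graded. For a homogeneous element $x$, the symbol $x$ in an exponent of $-1$ denotes its degree. $S(V)=\oplus_{i\ge0}S^i(V)$ is the (graded-commutative) symmetric algebra with product $\odot$. The Koszul sign $\varepsilon(\sigma)=\varepsilon(\sigma;v_1,\dots,v_n)$ is defined by $v_1\odot\cdots\odot v_n=\varepsilon(\sigma)\,v_{\sigma(1)}\odot\cdots\odot v_{\sigma(n)}$. $\mathbb S_{(i_1,\dots,i_k)}$ is the set of $(i_1,\dots,i_k)$-shuffles, i.e. permutations of $\{1,\dots,i_1+\cdots+i_k\}$ increasing on each of the consecutive blocks of sizes $i_1,\dots,i_k$ (empty if some $i_j<0$). $\mathrm{Hom}^n(S(V),W)$ is the space of degree $n$ linear maps; such $f$ is written $f=\sum_{i\ge0}f_i$ with $f_i:S^i(V)\to W$ ($f_0\in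 W^n$). A symmetric graded Lie algebra (sgLa) is a graded vector space $\mathfrak g$ with a bilinear bracket of degree $1$ such that $[x,y]_{\mathfrak g}=(-1)^{xy}[y,x]_{\mathfrak g}$ and $[x,[y,z]_{\mathfrak g}]_{\mathfrak g}=(-1)^{x+1}[[x,y]_{\mathfrak g},z]_{\mathfrak g}+(-1)^{(x+1)(y+1)}[y,[x,z]_{\mathfrak g}]_{\mathfrak g}$. Homomorphisms are degree $0$ bracket-preserving linear maps. $\mathfrak{gl}(V)=\oplus_n\mathrm{Hom}^n(V,V)$ with the graded commutator. $(s^{-1}W)^i=W^{i+1}$ is the desuspension, with degree $-1$ identity map $s^{-1}$; $s^{-1}\mathfrak{gl}(V)$ is a sgLa with $[s^{-1}f,s^{-1}g]:=(-1)^ms^{-1}[f,g]$ for $f$ of degree $m$. An action of a sgLa $\mathfrak g$ on a graded vector space $V$ is a degree $1$ linear map $\rho:\mathfrak g\to\mathfrak{gl}(V)$ such that $s^{-1}\circ\rho:\mathfrak g\to s^{-1}\mathfrak{gl}(V)$ is a sgLa homomorphism. A homotopy $\mathcal O$-operator of weight $0$ on $\mathfrak g$ with respect to $\rho$ is a degree $0$ element $T=\sum_{i\ge0}T_i\in\mathrm{Hom}(S(V),\mathfrak g)$, $T_i:S^i(V)\to\mathfrak g$, such that for all $p\ge0$ and homogeneous $v_1,\dots,v_p\in V$ (sums over $k\ge1$, $l\ge0$) $$\begin{aligned}&\sum_{k+l=p+1}\sum_{\sigma\in\mathbb S_{(l,1,p-l-1)}}\varepsilon(\sigma)T_{k-1}\Big(\rho\big(T_l(v_{\sigma(1)},\dots,v_{\sigma(l)})\big)v_{\sigma(l+1)},v_{\sigma(l+2)},\dots,v_{\sigma(p)}\Big)\\&=\frac12\sum_{k+l=p+1}\sum_{\sigma\in\mathbb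 S_{(k-1,l)}}\varepsilon(\sigma)[T_{k-1}(v_{\sigma(1)},\dots,v_{\sigma(k-1)}),T_l(v_{\sigma(k)},\dots,v_{\sigma(p)})]_{\mathfrak g}.\end{aligned}$$ A pre-Lie$_\infty$ algebra is a graded vector space $V$ with linear maps $\theta_k:\otimes^kV\to V$, $k\ge1$, of degree $1$ such that for all $n\ge1$ and homogeneous $v_1,\dots,v_n\in V$: (i) $\theta_n(v_{\sigma(1)},\dots,v_{\sigma(n-1)},v_n)=\varepsilon(\sigma)\theta_n(v_1,\dots,v_{n-1},v_n)$ for every $\sigma\in\mathbb S_{n-1}$; (ii) $$\begin{aligned}&\sum_{i+j=n+1,\ i\ge1,\ j\ge2}\ \sum_{\sigma\in\mathbb S_{(i-1,1,j-2)}}\varepsilon(\sigma)\theta_j(\theta_i(v_{\sigma(1)},\dots,v_{\sigma(i-1)},v_{\sigma(i)}),v_{\sigma(i+1)},\dots,v_{\sigma(n-1)},v_n)\\&+\sum_{i+j=n+1,\ i\ge1,\ j\ge1}\ \sum_{\sigma\in\mathbb S_{(j-1,i-1)}}(-1)^{v_{\sigma(1)}+\cdots+v_{\sigma(j-1)}}\varepsilon(\sigma)\theta_j(v_{\sigma(1)},\dots,v_{\sigma(j-1)},\theta_i(v_{\sigma(j)},\dots,v_{\sigma(n-1)},v_n))=0.\end{aligned}$$ *)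

(* Defs.v *)
From HB Require Import structures.
From mathcomp Require Import all_boot all_fingroup all_algebra.
Set Implicit Arguments.
Unset Strict Implicit.
Unset Printing Implicit Defensive.
Import GRing.Theory.
Local Open Scope ring_scope.

(* A graded vector space is an internally graded one: its total space together
   with the subspaces [gdeg V n] of degree [n] elements, of which the total
   space is the direct sum.  The zero vector is homogeneous of every degree. *)
Record gradedVect (F : fieldType) := GradedVect {
  gtotal :> lmodType F;
  gdeg : int -> gtotal -> Prop;
  gdeg0 : forall n, gdeg n 0;
  gdegP : forall n a x y, gdeg n x -> gdeg n y -> gdeg n (a *: x + y);
  gdeg_span : forall x, exists (s : seq int) (c : int -> gtotal),
    (forall n, gdeg n (c n)) /\ x = \sum_(n <- s) c n;
  gdeg_indep : forall (s : seq int) (c : int -> gtotal),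
    uniq s -> (forall n, gdeg n (c n)) -> \sum_(n <- s) c n = 0 ->
    forall n, n \in s -> c n = 0
}.

Definition homogeneous (F : fieldType) (V : gradedVect F) (p : nat)
    (d : 'I_p -> int) (v : 'I_p -> V) : Prop :=
  forall j, gdeg (d j) (v j).

Record sgLa (F : fieldType) := SgLa {
  sgLa_vect :> gradedVect F;
  bracket : sgLa_vect -> sgLa_vect -> sgLa_vect;
  bracket_linearl : forall y, linear (bracket^~ y);
  bracket_linearr : forall x, linear (bracket x);
  bracket_deg : forall m n x y,
    gdeg m x -> gdeg n y -> gdeg (m + n + 1) (bracket x y);
  bracket_sym : forall m n x y, gdeg m x -> gdeg n y ->
    bracket x y = (-1) ^ (m * n) *: bracket y x;
  bracket_jacobi : forall m n q x y z, gdeg m x -> gdeg n y -> gdeg q z ->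
    bracket x (bracket y z) =
      (-1) ^ (m + 1) *: bracket (bracket x y) z
      + (-1) ^ ((m + 1) * (n + 1)) *: bracket y (bracket x z)
}.

(* [is_hom n f] : f belongs to Hom^n(V, W). *)
Definition is_hom (F : fieldType) (V W : gradedVect F) (n : int)
    (f : V -> W) : Prop :=
  linear f /\ forall m x, gdeg m x -> gdeg (n + m) (f x).

(* The graded commutator of gl(V) on f, g of degrees m, n. *)
Definition gcomm (F : fieldType) (V : gradedVect F) (m n : int)
    (f g : V -> V) : V -> V :=
  fun v => f (g v) - (-1) ^ (m * n) *: g (f v).

(* The bracket of s^{-1}gl(V) on s^{-1}f, s^{-1}g, where f, g have degrees m, n
   in gl(V); the degree -1 identity map s^{-1} is left implicit. *)
Definition desusp_bracket (F : fieldType) (V : gradedVect F) (m n : int)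
    (f g : V -> V) : V -> V :=
  fun v => (-1) ^ m *: gcomm m n f g v.

(* By linearity of [act] and [act_deg], [act x] is a finite sum of homogeneous
   maps for every x, hence an element of gl(V) = \oplus_n Hom^n(V, V).
   [act_deg] also says that s^{-1} \o act has degree 0, and [act_bracket] that
   it preserves brackets. *)
Record sgLa_action (F : fieldType) (g : sgLa F) (V : gradedVect F) := SgLaAction {
  act :> g -> V -> V;
  act_linear : forall v, linear (act^~ v);
  act_linearr : forall x, linear (act x);
  act_deg : forall n x, gdeg n x -> is_hom (n + 1) (act x);
  act_bracket : forall m n x y, gdeg m x -> gdeg n y -> forall v,
    act (bracket x y) v = desusp_bracket (m + 1) (n + 1) (act x) (act y) v
}.

(* eps(s; v_1, ..., v_p) for v_j of degree d j : each pair that s puts out of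
   order contributes the sign (-1)^(product of the degrees). *)
Definition koszul (F : fieldType) (p : nat) (d : 'I_p -> int) (s : 'S_p) : F :=
  \prod_(i < p) \prod_(j < p | (i < j)%N && (s j < s i)%N)
    (-1) ^ (d (s i) * d (s j)).

(* Permutations of p letters increasing on each of the consecutive blocks of
   sizes sh = [:: i_1; ...; i_k].  A size that would be negative is truncated to
   0 by the subtraction on nat; the sizes then no longer add up to p and the set
   is empty, as required. *)
Definition shuffles (p : nat) (sh : seq nat) : {set 'S_p} :=
  [set s : 'S_p | (sumn sh == p) &&
    [forall i : 'I_p, forall j : 'I_p,
      (i < j)%N && (reshape_index sh i == reshape_index sh j)
      ==> (s i < s j)%N]].

(* Families (f_i)_i of maps in i variables. *)
Definition multimap (F : fieldType) (V W : gradedVect F) :=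
  forall i, i.-tuple V -> W.

(* f_i(v_1, ..., v_i) for the sequence [:: v_1; ...; v_i]. *)
Definition app (F : fieldType) (V W : gradedVect F) (f : multimap V W)
    (vs : seq V) : W :=
  f (size vs) (in_tuple vs).

(* Each f_i, i >= 1, is a linear map on the i-th tensor power of V. *)
Definition multilinear (F : fieldType) (V W : gradedVect F)
    (f : multimap V W) : Prop :=
  forall (s1 s2 : seq V) (a : F) (x y : V),
    app f (s1 ++ (a *: x + y) :: s2) =
      a *: app f (s1 ++ x :: s2) + app f (s1 ++ y :: s2).

(* f belongs to Hom^n(S(V), W) : a linear map on S^i(V) is an i-linear map
   invariant under the relations v_1 (.) ... (.) v_i =
   eps(s) v_{s(1)} (.) ... (.) v_{s(i)}; for i = 0 it is an element of W. *)
Definition is_symhom (F : fieldType) (V W : gradedVect F) (n : int)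
    (f : multimap V W) : Prop :=
  [/\ multilinear f,
      (forall i (d : 'I_i -> int) (v : 'I_i -> V), homogeneous d v ->
         gdeg (n + \sum_(j < i) d j) (app f (codom v)))
    & (forall i (d : 'I_i -> int) (v : 'I_i -> V), homogeneous d v ->
         forall s : 'S_i,
         app f (codom v) = koszul F d s *: app f (codom (v \o s)))].

(* Below, w is the sequence v_{s(1)}, ..., v_{s(p)}, indexed from 0. *)
Definition homotopy_O_operator (F : fieldType) (g : sgLa F) (V : gradedVect F)
    (rho : sgLa_action g V) (T : multimap V g) : Prop :=
  is_symhom 0 T /\
  forall p (d : 'I_p -> int) (v : 'I_p -> V), homogeneous d v ->
    \sum_(1 <= k < p.+2) \sum_(0 <= l < p.+1 | (k + l == p.+1)%N)
      \sum_(s in shuffles p [:: l; 1; p - l - 1]%N)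
        (let w := codom (v \o s) in
         koszul F d s *:
           app T (rho (app T (take l w)) (nth 0 w l) :: drop l.+1 w))
    = 2^-1 *:
    \sum_(1 <= k < p.+2) \sum_(0 <= l < p.+1 | (k + l == p.+1)%N)
      \sum_(s in shuffles p [:: k - 1; l]%N)
        (let w := codom (v \o s) in
         koszul F d s *:
           bracket (app T (take (k - 1) w)) (app T (drop (k - 1) w))).

(* theta_k for k >= 1; the component of index 0 is ignored.  With n = m + 1, the
   arguments v_1, ..., v_{n-1} are given by v : 'I_m -> V and v_n by u; w is the
   sequence v_{s(1)}, ..., v_{s(n-1)}. *)
Definition preLie_infty (F : fieldType) (V : gradedVect F)
    (theta : multimap V V) : Prop :=
  [/\ multilinear theta,
      (forall k (d : 'I_k -> int) (v : 'I_k -> V), (1 <= k)%N ->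
         homogeneous d v -> gdeg (1 + \sum_(j < k) d j) (app theta (codom v))),
      (forall m (d : 'I_m -> int) (v : 'I_m -> V) (e : int) (u : V),
         homogeneous d v -> gdeg e u -> forall s : 'S_m,
         app theta (codom (v \o s) ++ [:: u]) =
           koszul F d s *: app theta (codom v ++ [:: u]))
    & (forall m (d : 'I_m -> int) (v : 'I_m -> V) (e : int) (u : V),
         homogeneous d v -> gdeg e u ->
         let n := m.+1 in
         \sum_(1 <= i < n.+1) \sum_(2 <= j < n.+1 | (i + j == n.+1)%N)
           \sum_(s in shuffles m [:: i - 1; 1; j - 2]%N)
             (let w := codom (v \o s) in
              koszul F d s *:
                app theta (app theta (take i w) :: drop i w ++ [:: u]))
         + \sum_(1 <= i < n.+1) \sum_(1 <= j < n.+1 | (i + j == n.+1)%N)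
           \sum_(s in shuffles m [:: j - 1; i - 1]%N)
             (let w := codom (v \o s) in
              ((-1) ^ (\sum_(t < m | (t < j - 1)%N) d (s t)) * koszul F d s) *:
                app theta (take (j - 1) w
                           ++ [:: app theta (drop (j - 1) w ++ [:: u])]))
         = 0)].

(* theta_k(v_1, ..., v_k) = rho(T_{k-1}(v_1, ..., v_{k-1})) v_k *)
Definition theta_of (F : fieldType) (g : sgLa F) (V : gradedVect F)
    (rho : sgLa_action g V) (T : multimap V g) : multimap V V :=
  fun k vs => rho (app T (take (k - 1) vs)) (nth 0 vs (k - 1)).

(* Main.v *)
Require Import Defs.
From HB Require Import structures.
From mathcomp Require Import all_boot all_fingroup all_algebra.
From mathcomp Require Import zify ring.
Set Implicit Arguments.
Unset Strict Implicit.
Unset Printing Implicit Defensive.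
Import GRing.Theory.
Local Open Scope ring_scope.

(** Everything except the last identity is inherited from [T] and [rho]:
    theta_k is [rho (T_{k-1} ...)] applied to the last argument, so its
    multilinearity, degree and symmetry come from those of [T].

    For the last identity, fix [v_1, ..., v_p] and [u].  Its first sum is
    [rho L u], where [L] is the left hand side of the O-operator equation
    ([theta_rho_sum]).  Hence it equals
    [1/2 \sum eps(s) rho [x, y] u] over the shuffles [s] of type [(a, p - a)],
    [x] and [y] being [T] of the first and of the second block.  As [rho] is an
    action,
      [rho [x, y] u = - (-1)^|x| rho x (rho y u)
                      - (-1)^(|x||y| + |y|) rho y (rho x u)].
    Since [T] has degree 0, [|x|] is the sum of the degrees of the first block,
    and so [eps(s) (-1)^|x| rho x (rho y u)] is exactly the term [act_pair a s]
    of the second sum of the identity ([theta_act_pair_sum]).  The other half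
    is the same kind of term for the shuffle of type [(p - a, a)] obtained by
    exchanging the two blocks, because this exchange multiplies the Koszul sign
    by [(-1)^(|x||y|)] ([act_bracket_pair]).  Exchanging blocks is a bijection
    between shuffles of types [(a, p - a)] and [(p - a, a)]
    ([sum_shuffles_swap]), so both halves have the same total, the factor 1/2
    disappears, and the first sum is minus the second ([sum_act_bracket]). *)

(** * Signs *)

Lemma exprNz_add (F : fieldType) (m n : int) :
  (-1) ^ (m + n) = (-1) ^ m * (-1) ^ n :> F.
Proof. by rewrite expfzDr // oppr_eq0 oner_eq0. Qed.

Lemma exprNz_sqr (F : fieldType) (m : int) : (-1) ^ m * (-1) ^ m = 1 :> F.
Proof. by rewrite -expfzMl mulrNN mulr1 exp1rz. Qed.

Lemma exprNz_sum (F : fieldType) (I : Type) (r : seq I) (P : pred I)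
    (E : I -> int) :
  (-1) ^ (\sum_(i <- r | P i) E i) = \prod_(i <- r | P i) (-1) ^ E i :> F.
Proof.
exact: (big_morph (fun n : int => (-1) ^ n : F) (exprNz_add F) (expr0z _)).
Qed.

Lemma koszul_sqr (F : fieldType) (p : nat) (d : 'I_p -> int) (s : 'S_p) :
  koszul F d s * koszul F d s = 1.
Proof.
rewrite -big_split big1 //= => i _; rewrite -big_split big1 //= => j _.
exact: exprNz_sqr.
Qed.

(** The Koszul sign is a cocycle.  A pair of positions is out of order in the
    product when it is so for exactly one of: [t], or [s] on the images under
    [t]; a pair counted by both contributes the square of a sign. *)
Lemma koszul_mulg (F : fieldType) (p : nat) (d : 'I_p -> int) (s t : 'S_p) :
  koszul F d (t * s)%g = koszul F d s * koszul F (d \o s) t.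
Proof.
pose chi i j : F := (-1) ^ (d (s (t i)) * d (s (t j))).
pose factor_if (b : bool) (x : F) := if b then x else 1.
have move_cond (P : rel 'I_p) (G : 'I_p -> 'I_p -> F) :
    \prod_(i < p) \prod_(j < p | (i < j)%N && P i j) G i j
    = \prod_(i < p) \prod_(j < p | (i < j)%N) factor_if (P i j) (G i j).
  by apply: eq_bigr => i _; rewrite big_mkcondr.
(* Reindexed by t, the product for s runs over pairs with t i < t j; the pairs
   with j < i are renamed so that both products run over i < j. *)
have -> : koszul F d s = \prod_(i < p) \prod_(j < p | (i < j)%N)
    (factor_if ((t i < t j)%N && (s (t j) < s (t i))%N) (chi i j)
     * factor_if ((t j < t i)%N && (s (t i) < s (t j))%N) (chi i j)).
  rewrite /koszul (reindex_inj (@perm_inj _ t)) /=.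
  under eq_bigr => i _.
    rewrite (reindex_inj (@perm_inj _ t)) big_mkcond.
    rewrite (bigID (fun j : 'I_p => (i < j)%N)) /=.
    over.
  under [RHS]eq_bigr => i _ do rewrite big_split /=.
  rewrite !big_split /=; congr (_ * _).
  rewrite [RHS](exchange_big_dep xpredT) //=.
  apply: eq_bigr => i _; rewrite big_mkcond [RHS]big_mkcond /=.
  apply: eq_bigr => j _; rewrite -leqNgt leq_eqVlt.
  have [/val_inj-> | _] /= := eqVneq (j : nat) i; first by rewrite !ltnn.
  by rewrite /factor_if /chi mulrC.
rewrite /koszul !move_cond -big_split /=; apply: eq_bigr => i _.
rewrite -big_split /=; apply: eq_bigr => j ltij.
have sq := exprNz_sqr F (d (s (t i)) * d (s (t j))).
rewrite !permM /factor_if /chi.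
have neq_t : (t i != t j :> nat).
  by apply: contraTneq ltij => /val_inj/perm_inj ->; rewrite ltnn.
have neq_s : (s (t i) != s (t j) :> nat).
  by apply: contraNneq neq_t => /val_inj/perm_inj ->.
case: (ltngtP (t i) (t j)) neq_t => // _ _;
  case: (ltngtP (s (t i)) (s (t j))) neq_s => //= _ _;
  by rewrite ?mulr1 ?mul1r ?sq.
Qed.

(** * Exchanging the two blocks of a shuffle *)

(** Rotation by [a] places: [block_rot p a * s] first runs through the values of
    [s] on the positions [a, ..., p - 1], then through those on the positions
    [0, ..., a - 1]. *)
Definition block_rot (p a : nat) : 'S_p := (perm (@ordS_inj p) ^+ a)%g.

Lemma block_rotE (p a : nat) (i : 'I_p) :
  block_rot p a i = ((i + a) %% p)%N :> nat.
Proof.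
rewrite /block_rot permX; elim: a => [|a IHa] /=.
  by rewrite addn0 modn_small.
by rewrite permE /= IHa -[(_ %% p).+1]addn1 modnDml addn1 addnS.
Qed.

Lemma block_rotE_if (p a : nat) (i : 'I_p) : (a <= p)%N ->
  block_rot p a i = (if i < p - a then i + a else i - (p - a))%N :> nat.
Proof.
move=> leap; rewrite block_rotE; have := ltn_ord i.
case: (ltnP i (p - a)) => h hi; first by rewrite modn_small //; lia.
have -> : (i + a = (i - (p - a)) + p)%N by lia.
by rewrite modnDr modn_small //; lia.
Qed.

(** The pairs put out of order are those with one letter in each block. *)
Lemma koszul_block_rot (F : fieldType) (p a : nat) (d : 'I_p -> int) :
  (a <= p)%N ->
  koszul F d (block_rot p a) =
    (-1) ^ ((\sum_(t < p | (t < a)%N) d t) * (\sum_(t < p | (a <= t)%N) d t)).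
Proof.
move=> leap; rewrite /koszul.
transitivity (\prod_(i < p | (i < p - a)%N) \prod_(j < p | (p - a <= j)%N)
   (-1) ^ (d (block_rot p a i) * d (block_rot p a j)) : F).
  rewrite [RHS]big_mkcond /=; apply: eq_bigr => i _.
  case: ifP => hi.
    by apply: eq_bigl => j; rewrite !block_rotE_if // hi;
      have := ltn_ord j; case: ifP; lia.
  by apply: big_pred0 => j; rewrite !block_rotE_if // hi;
    have := ltn_ord j; case: ifP; lia.
rewrite mulrC big_distrlr /= exprNz_sum.
rewrite [RHS](reindex_inj (@perm_inj _ (block_rot p a))) /=.
apply: eq_big => [i|i _].
  by rewrite block_rotE_if //; have := ltn_ord i; case: ifP; lia.
rewrite exprNz_sum [RHS](reindex_inj (@perm_inj _ (block_rot p a))) /=.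
apply: eq_bigl => j.
by rewrite block_rotE_if //; have := ltn_ord j; case: ifP; lia.
Qed.

Lemma in_shuffles2 (p a : nat) (s : 'S_p) : (a <= p)%N ->
  (s \in shuffles p [:: a; p - a]%N) =
  [forall i : 'I_p, forall j : 'I_p,
    (i < j)%N && ((i < a)%N == (j < a)%N) ==> (s i < s j)%N].
Proof.
move=> leap.
have E (i : 'I_p) : reshape_index [:: a; p - a]%N i = (a <= i)%N.
  rewrite /reshape_index /= subn_eq0; have := ltn_ord i.
  by case: (ltnP i a) => h hi //; have -> : (i.+1 - a - (p - a) == 0)%N by lia.
rewrite inE /= addn0 subnKC // eqxx; apply: eq_forallb => i.
by apply: eq_forallb => j; rewrite !E; case: (ltnP i a); case: (ltnP j a).
Qed.

Lemma block_rot_shuffles (p a : nat) (s : 'S_p) : (a <= p)%N ->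
  ((block_rot p a * s)%g \in shuffles p [:: p - a; a]%N) =
  (s \in shuffles p [:: a; p - a]%N).
Proof.
move=> leap.
have := in_shuffles2 (block_rot p a * s)%g (leq_subr a p).
rewrite (subKn leap) in_shuffles2 // => ->.
pose r := block_rot p a.
(* The rotation preserves the order within a block, which is all that the
   shuffle condition sees. *)
have rE (i j : 'I_p) : (r i < r j)%N && ((r i < a)%N == (r j < a)%N) =
    (i < j)%N && ((i < p - a)%N == (j < p - a)%N).
  rewrite !block_rotE_if //; have := ltn_ord i; have := ltn_ord j.
  by case: ifP; case: ifP; lia.
apply/forallP/forallP => H i; apply/forallP => j.
  by have /forallP/(_ (r^-1 j)%g) := H (r^-1 i)%g; rewrite -rE !permM !permKV.
by rewrite !permM -rE; have /forallP/(_ (r j)) := H (r i).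
Qed.

Lemma sum_shuffles_swap (W : nmodType) (p a : nat) (G : 'S_p -> W) :
  (a <= p)%N ->
  \sum_(s in shuffles p [:: p - a; a]%N) G s =
  \sum_(s in shuffles p [:: a; p - a]%N) G (block_rot p a * s)%g.
Proof.
move=> leap; rewrite (reindex_inj (mulgI (block_rot p a))) /=.
by apply: eq_bigl => s; rewrite block_rot_shuffles.
Qed.

(** * Degrees of the values on a block *)

Lemma nth_codom_ord (A : Type) (x0 : A) (p : nat) (f : 'I_p -> A) (i : 'I_p) :
  nth x0 (codom f) i = f i.
Proof. by rewrite codomE (nth_map i) ?size_enum_ord // nth_ord_enum. Qed.

Lemma size_codom_ord (A : Type) (p : nat) (f : 'I_p -> A) : size (codom f) = p.
Proof. by rewrite size_codom card_ord. Qed.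

Lemma codom_nth (A : Type) (x0 : A) (s : seq A) :
  codom (fun i : 'I_(size s) => nth x0 s i) = s.
Proof.
apply: (@eq_from_nth _ x0); rewrite size_codom_ord // => i lti.
by rewrite -[i]/(val (Ordinal lti)) nth_codom_ord.
Qed.

Lemma codom_block_rot (A : Type) (p a : nat) (f : 'I_p -> A) : (a <= p)%N ->
  codom (f \o block_rot p a) = drop a (codom f) ++ take a (codom f).
Proof.
case: p f => [|p] f leap.
  by move: leap; rewrite leqn0 => /eqP->; rewrite drop0 take0 cats0 !codomE;
    apply: eq_map => -[].
apply: (@eq_from_nth _ (f ord0)).
  by rewrite -[RHS]/(size (rot a _)) size_rot !size_codom_ord.
move=> i; rewrite size_codom_ord => lti.
rewrite -[i]/(val (Ordinal lti)) nth_codom_ord /=.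
rewrite -[LHS](nth_codom_ord (f ord0)).
rewrite block_rotE_if //= nth_cat size_drop size_codom_ord.
case: ifP => h; first by rewrite nth_drop addnC.
by rewrite nth_take //; lia.
Qed.

Lemma gdeg_app (F : fieldType) (V W : gradedVect F) (n : int)
    (f : multimap V W) (ws : seq V) (D : nat -> int) :
  is_symhom n f ->
  (forall i, (i < size ws)%N -> gdeg (D i) (nth 0 ws i)) ->
  gdeg (n + \sum_(i < size ws) D i) (app f ws).
Proof.
case=> _ degf _ hws; rewrite -[X in app f X](codom_nth 0).
exact: (degf _ (fun i : 'I_(size ws) => D i)) (fun i => hws _ (ltn_ord i)).
Qed.

Section Blocks.
Variables (F : fieldType) (V W : gradedVect F) (n : int) (f : multimap V W).
Variables (p a : nat) (e : 'I_p -> int) (w : 'I_p -> V).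
Hypotheses (symf : is_symhom n f) (leap : (a <= p)%N) (hw : homogeneous e w).

Lemma gdeg_app_take :
  gdeg (n + \sum_(t < p | (t < a)%N) e t) (app f (take a (codom w))).
Proof.
have szw : size (take a (codom w)) = a by rewrite size_takel ?size_codom_ord.
have := @gdeg_app F V W n f (take a (codom w)) (nth 0 (codom e)) symf.
rewrite szw (big_ord_narrow leap).
under [X in gdeg (n + X)]eq_bigr => i _.
  rewrite -[i : nat]/(val (widen_ord leap i)) nth_codom_ord; over.
apply=> i lti; rewrite nth_take // -[i]/(val (Ordinal (leq_trans lti leap))).
by rewrite !nth_codom_ord; apply: hw.
Qed.

Lemma gdeg_app_drop :
  gdeg (n + \sum_(t < p | (a <= t)%N) e t) (app f (drop a (codom w))).
Proof.
have szw : size (drop a (codom w)) = (p - a)%N.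
  by rewrite size_drop size_codom_ord.
have := @gdeg_app F V W n f (drop a (codom w))
  (fun i => nth 0 (codom e) (i + a)%N) symf.
rewrite szw; have -> : \sum_(i < p - a) nth 0 (codom e) (i + a)%N
    = \sum_(t < p | (a <= t)%N) e t.
  rewrite -(big_mkord xpredT (fun i => nth 0 (codom e) (i + a)%N)).
  rewrite -(big_addn 0 p a xpredT (nth 0 (codom e))) add0n big_geq_mkord /=.
  by apply: eq_bigr => i _; rewrite nth_codom_ord.
apply=> i lti; rewrite nth_drop (addnC a).
have lti' : (i + a < p)%N by lia.
by rewrite -[(i + a)%N]/(val (Ordinal lti')) !nth_codom_ord; apply: hw.
Qed.

End Blocks.

(** * Sums *)

(** The maps at hand are bare functions with a proof of linearity, to which the
    lemmas on bundled linear maps do not apply. *)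
Lemma linear_sumZ (F : fieldType) (U W : lmodType F) (f : U -> W) :
  linear f ->
  [/\ forall c x, f (c *: x) = c *: f x
    & forall (I : Type) (r : seq I) (P : pred I) (E : I -> U),
      f (\sum_(i <- r | P i) E i) = \sum_(i <- r | P i) f (E i)].
Proof.
move=> linf; have f0 : f 0 = 0.
  by apply: (addIr (f 0)); have := linf 1 0 0; rewrite !scale1r addr0 add0r.
split=> [c x|I r P E]; first by rewrite -[c *: x]addr0 linf f0 addr0.
by apply: (big_morph f _ f0) => x y; have := linf 1 x y; rewrite !scale1r.
Qed.

(** Covers the double sums of both identities with [a] and [b] in {0, 1}; the
    one lower bound 2 is first replaced by 1, which adds an empty set of
    shuffles. *)
Lemma sum_antidiag (W : nmodType) (a b p : nat) (G : nat -> nat -> W) :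
  \sum_(a <= k < (a + p).+1) \sum_(b <= l < (b + p).+1 | (k + l == a + b + p)%N)
     G k l =
  \sum_(i < p.+1) G (a + i)%N (b + (p - i))%N.
Proof.
rewrite -{1}[a]add0n big_addn -addnS addKn big_mkord.
apply: eq_bigr => i _; have lti := ltn_ord i.
under eq_bigl => l.
  have -> : (i + a + l == a + b + p)%N = (l == (b + (p - i)))%N by lia.
  over.
by rewrite big_nat1_eq ifT 1?addnC //; lia.
Qed.

(** * The action on the values of the operator *)

Lemma app_theta_rcons (F : fieldType) (g : sgLa F) (V : gradedVect F)
    (rho : sgLa_action g V) (T : multimap V g) (s : seq V) (u : V) :
  app (theta_of rho T) (rcons s u) = rho (app T s) u.
Proof.
rewrite /app /theta_of /= size_rcons subn1 /= nth_rcons ltnn eqxx.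
by rewrite -cats1 take_size_cat.
Qed.

Section ActionOnOperator.
Variables (F : fieldType) (g : sgLa F) (V : gradedVect F).
Variables (rho : sgLa_action g V) (T : multimap V g) (p : nat).
Variables (d : 'I_p -> int) (v : 'I_p -> V) (u : V).
Hypotheses (symT : is_symhom 0 T) (hv : homogeneous d v).

(** The term of the shuffle [s], with first block of size [a], in the second sum
    of the last pre-Lie infinity identity. *)
Definition act_pair (a : nat) (s : 'S_p) : V :=
  let w := codom (v \o s) in
  ((-1) ^ (\sum_(t < p | (t < a)%N) d (s t)) * koszul F d s) *:
    rho (app T (take a w)) (rho (app T (drop a w)) u).

Lemma act_pair_swap (a : nat) (s : 'S_p) : (a <= p)%N ->
  let w := codom (v \o s) in
  let m := \sum_(t < p | (t < a)%N) d (s t) in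
  let n := \sum_(t < p | (a <= t)%N) d (s t) in
  act_pair (p - a) (block_rot p a * s)%g =
    ((-1) ^ n * (-1) ^ (m * n) * koszul F d s) *:
      rho (app T (drop a w)) (rho (app T (take a w)) u).
Proof.
move=> leap w m n; rewrite /act_pair.
have -> : codom (v \o (block_rot p a * s)%g) = drop a w ++ take a w.
  rewrite -codom_block_rot //.
  by apply: eq_codom => i; rewrite /= permM.
have szw : size (drop a w) = (p - a)%N by rewrite size_drop size_codom_ord.
rewrite take_size_cat // drop_size_cat // koszul_mulg koszul_block_rot //.
have -> : \sum_(t < p | (t < p - a)%N) d ((block_rot p a * s)%g t) = n.
  rewrite /n [RHS](reindex_inj (@perm_inj _ (block_rot p a))) /=.
  apply: eq_big => [i|i _]; last by rewrite permM.
  by rewrite block_rotE_if //; have := ltn_ord i; case: ifP; lia.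
by rewrite [koszul F d s * _]mulrC mulrA.
Qed.

(** The two terms of the graded commutator correspond to [s] and to the
    permutation that exchanges its two blocks. *)
Lemma act_bracket_pair (a : nat) (s : 'S_p) : (a <= p)%N ->
  let w := codom (v \o s) in
  koszul F d s *: rho (bracket (app T (take a w)) (app T (drop a w))) u =
    - (act_pair a s + act_pair (p - a) (block_rot p a * s)%g).
Proof.
move=> leap w; rewrite act_pair_swap //.
have hw : homogeneous (d \o s) (v \o s) by move=> i; apply: hv.
have := gdeg_app_take symT leap hw; have := gdeg_app_drop symT leap hw.
rewrite !add0r => degy degx.
rewrite (act_bracket rho degx degy) /desusp_bracket /gcomm /act_pair -/w /=.
set m := \sum_(t < p | (t < a)%N) _; set n := \sum_(t < p | (a <= t)%N) _.
rewrite mulrDl mul1r mulrDr mulr1 !exprNz_add expr1z.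
rewrite scalerA scalerBr scalerA opprD -!scaleNr.
congr (_ *: _ + _ *: _); first by rewrite !mulrN1 mulrN mulrC.
(* Here (|x|+1) + (|x|+1)(|y|+1) = |x||y| + |y| modulo 2. *)
have := exprNz_sqr F m; move: ((-1) ^ m) => x sqx.
by ring: sqx.
Qed.

(** Exchanging the blocks of all shuffles matches the two terms, so their totals
    agree and cancel the 1/2. *)
Lemma sum_act_bracket : [pchar F] =i pred0 ->
  2^-1 *: (\sum_(a < p.+1) \sum_(s in shuffles p [:: a : nat; p - a]%N)
    (let w := codom (v \o s) in
     koszul F d s *: rho (bracket (app T (take a w)) (app T (drop a w))) u))
  = - \sum_(a < p.+1) \sum_(s in shuffles p [:: a : nat; p - a]%N) act_pair a s.
Proof.
move=> charF0; have two_neq0 : (2 : F) != 0 by move/pcharf0P: charF0 => ->.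
have swapped : \sum_(a < p.+1)
      \sum_(s in shuffles p [:: a : nat; p - a]%N) act_pair a s
    = \sum_(a < p.+1) \sum_(s in shuffles p [:: a : nat; p - a]%N)
      act_pair (p - a) (block_rot p a * s)%g.
  rewrite (reindex_inj rev_ord_inj) /=; apply: eq_bigr => a _.
  have leap : (a <= p)%N by rewrite -ltnS.
  by rewrite subSS subKn // sum_shuffles_swap.
set S := \sum_(a < p.+1) _ in swapped *.
have -> : \sum_(a < p.+1) \sum_(s in shuffles p [:: a : nat; p - a]%N)
    (let w := codom (v \o s) in
     koszul F d s *: rho (bracket (app T (take a w)) (app T (drop a w))) u)
    = - (S + S).
  rewrite {2}swapped /S -big_split /= -sumrN.
  apply: eq_bigr => a _; rewrite -big_split /= -sumrN.
  by apply: eq_bigr => s _; apply: act_bracket_pair; rewrite -ltnS.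
by rewrite scalerN -mulr2n -scaler_nat scalerA mulVf // scale1r.
Qed.

End ActionOnOperator.

(** * The identities in terms of shuffles *)

Lemma homotopy_O_operator_antidiag (F : fieldType) (g : sgLa F)
    (V : gradedVect F) (rho : sgLa_action g V) (T : multimap V g) (p : nat)
    (d : 'I_p -> int) (v : 'I_p -> V) :
  homotopy_O_operator rho T -> homogeneous d v ->
  \sum_(l < p.+1) \sum_(s in shuffles p [:: l : nat; 1; p - l - 1]%N)
    (let w := codom (v \o s) in
     koszul F d s *: app T (rho (app T (take l w)) (nth 0 w l) :: drop l.+1 w))
  = 2^-1 *:
  \sum_(a < p.+1) \sum_(s in shuffles p [:: a : nat; p - a]%N)
    (let w := codom (v \o s) in
     koszul F d s *: bracket (app T (take a w)) (app T (drop a w))).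
Proof.
case=> _ hO hv; have := hO p d v hv.
rewrite (sum_antidiag 1 0 p) (sum_antidiag 1 0 p) => hO_p.
apply: etrans (etrans hO_p _).
  rewrite (reindex_inj rev_ord_inj) /=; apply: eq_bigr => l _.
  by rewrite subSS add0n.
by congr (_ *: _); apply: eq_bigr => a _; rewrite add0n add1n subn1.
Qed.

(** The first sum of the last identity is [rho] of the left hand side of the
    O-operator equation, evaluated at the last argument: the outer theta acts
    through [T] of all its arguments but the last, and the inner theta is the
    first of them. *)
Lemma theta_rho_sum (F : fieldType) (g : sgLa F)
    (V : gradedVect F) (rho : sgLa_action g V) (T : multimap V g) (p : nat)
    (d : 'I_p -> int) (v : 'I_p -> V) (u : V) :
  \sum_(1 <= i < p.+2) \sum_(2 <= j < p.+2 | (i + j == p.+2)%N)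
    \sum_(s in shuffles p [:: i - 1; 1; j - 2]%N)
      (let w := codom (v \o s) in
       koszul F d s *:
         app (theta_of rho T)
           (app (theta_of rho T) (take i w) :: drop i w ++ [:: u]))
  = rho (\sum_(l < p.+1) \sum_(s in shuffles p [:: l : nat; 1; p - l - 1]%N)
    (let w := codom (v \o s) in
     koszul F d s *:
       app T (rho (app T (take l w)) (nth 0 w l) :: drop l.+1 w))) u.
Proof.
have [linZ lin_sum] := linear_sumZ (act_linear rho u).
have shuffles_l_lt (l j : nat) (s : 'S_p) :
  s \in shuffles p [:: l; 1; j]%N -> (l < p)%N.
  by rewrite inE /= => /andP[/eqP szp _]; lia.
pose G (i j : nat) := \sum_(s in shuffles p [:: i - 1; 1; j - 2]%N)
  (let w := codom (v \o s) in
   koszul F d s *: app (theta_of rho T)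
     (app (theta_of rho T) (take i w) :: drop i w ++ [:: u])).
(* The index j = 1 may be added: its blocks would have p + 1 letters in all. *)
transitivity (\sum_(1 <= i < p.+2) \sum_(1 <= j < p.+2 | (i + j == p.+2)%N)
  G i j).
  apply: eq_big_nat => i /andP[i_gt0 _]; rewrite [RHS]big_ltn_cond //.
  case: ifP => // /eqP ij; rewrite [G i 1]big_pred0 ?add0r // => s.
  by apply/negP => /shuffles_l_lt; lia.
rewrite (sum_antidiag 1 1 p) lin_sum; apply: eq_bigr => l _.
rewrite lin_sum /G !add1n subn1 subSS /=; apply: eq_bigr => s hs.
have ltl := shuffles_l_lt _ _ _ hs.
rewrite (take_nth 0) ?size_codom_ord // app_theta_rcons linZ cats1.
by rewrite -rcons_cons app_theta_rcons.
Qed.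

Lemma theta_act_pair_sum (F : fieldType) (g : sgLa F)
    (V : gradedVect F) (rho : sgLa_action g V) (T : multimap V g) (p : nat)
    (d : 'I_p -> int) (v : 'I_p -> V) (u : V) :
  \sum_(1 <= i < p.+2) \sum_(1 <= j < p.+2 | (i + j == p.+2)%N)
    \sum_(s in shuffles p [:: j - 1; i - 1]%N)
      (let w := codom (v \o s) in
       ((-1) ^ (\sum_(t < p | (t < j - 1)%N) d (s t)) * koszul F d s) *:
         app (theta_of rho T) (take (j - 1) w
           ++ [:: app (theta_of rho T) (drop (j - 1) w ++ [:: u])]))
  = \sum_(a < p.+1) \sum_(s in shuffles p [:: a : nat; p - a]%N)
      act_pair rho T d v u a s.
Proof.
rewrite (sum_antidiag 1 1 p) (reindex_inj rev_ord_inj) /=.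
apply: eq_bigr => a _; have leap : (a <= p)%N by rewrite -ltnS.
rewrite !add1n !subn1 !succnK subSS (subKn leap).
by apply: eq_bigr => s _; rewrite !cats1 !app_theta_rcons.
Qed.

Theorem corollary3p12 (F : fieldType) (charF0 : [pchar F] =i pred0)
    (g : sgLa F) (V : gradedVect F) (rho : sgLa_action g V) (T : multimap V g)
    (hT : homotopy_O_operator rho T) :
  preLie_infty (theta_of rho T).
Proof.
have [symT _] := hT; have [multT degT signT] := symT.
split.
- move=> s1 s2 a x y; case/lastP: s2 => [|s2 z].
    by rewrite !cats1 !app_theta_rcons act_linearr.
  by rewrite -!rcons_cons -!rcons_cat !app_theta_rcons multT act_linear.
- case=> // k d v _ hv.
  pose widen := widen_ord (leqnSn k).
  have -> : codom v = rcons (codom (v \o widen)) (v ord_max).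
    by rewrite !codomE enum_ordSr map_rcons -map_comp.
  rewrite app_theta_rcons big_ord_recr /= addrA [1 + _]addrC.
  have [_] := act_deg rho (degT k _ _ (fun i => hv (widen i))).
  by rewrite add0r; apply; apply: hv.
- move=> p d v e u hv _ s; rewrite !cats1 !app_theta_rcons (signT _ _ _ hv s).
  have [linZ _] := linear_sumZ (act_linear rho u).
  by rewrite linZ scalerA koszul_sqr scale1r.
- move=> p d v e u hv _ n.
  have [linZ lin_sum] := linear_sumZ (act_linear rho u).
  rewrite theta_rho_sum theta_act_pair_sum homotopy_O_operator_antidiag // linZ.
  rewrite lin_sum; apply/eqP; rewrite addr_eq0; apply/eqP.
  rewrite -(sum_act_bracket rho u symT hv charF0); congr (_ *: _).
  apply: eq_bigr => a _; rewrite lin_sum.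
  by apply: eq_bigr => s _; rewrite linZ.
Qed.
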